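(* Let $f:\mathbb{R}^n\to\mathbb{R}$ be a smooth ($\mathcal{C}^1$) convex function whose gradient is Lipschitz continuous with constant $L>0$. Given any initial point $x^1\in\mathbb{R}^n$, let $\{x^k\}$ be generated by the iterative procedure $$x^{k+1}=x^k-t_k\nabla f\left(x^k+\rho_k\frac{\nabla f(x^k)}{\|\nabla f(x^k)\|}\right)\quad\text{for all }k\in\mathbb{N},$$ with nonnegative stepsizes $t_k$ and nonnegative perturbation radii $\rho_k$ satisfying $$\sum_{k=1}^\infty t_k^2<\infty,\qquad \sum_{k=1}^\infty t_k=\infty,\qquad \sup_{k\in\mathbb{N}}\rho_k<\infty.$$ Assume that $\nabla f(x^k)\neq 0$ for all $k\in\mathbb{N}$ and that $\inf_{k\in\mathbb{N}} f(x^k)>-\infty$. Then the following assertions hold: (i) $\liminf_{k\to\infty}\|\nabla f(x^k)\|=0$. (ii) If $f$ has a nonempty bounded level set, then $\{x^k\}$ is bounded, every accumulation point of $\{x^k\}$ is a global minimizer of $f$, and $\{f(x^k)\}$ converges to the optimal value of $f$. If in addition $f$ has a unique minimizer, then the sequence $\{x^k\}$ converges to that minimizer.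
   Context: $\mathbb{N}=\{1,2,\ldots\}$, and $\|\cdot\|$ is the Euclidean norm on $\mathbb{R}^n$. A level set of $f$ is a set of the form $\{x\in\mathbb{R}^n : f(x)\le\alpha\}$ with $\alpha\in\mathbb{R}$. The optimal value of $f$ is $\inf_{x\in\mathbb{R}^n}f(x)$. *)

(* Defs.v *)
From HB Require Import structures.
From mathcomp Require Import all_boot all_order all_algebra.
From mathcomp Require Import all_classical all_reals all_analysis.
Set Implicit Arguments.
Unset Strict Implicit.
Unset Printing Implicit Defensive.
Import Order.TTheory GRing.Theory Num.Theory.
Import numFieldNormedType.Exports.
Local Open Scope classical_set_scope.
Local Open Scope ring_scope.

(* [`|v|] on ['rV[R]_n] is the sup norm, so the Euclidean norm is defined here.
   The two are equivalent: limits, [differentiable], [continuous], [cluster]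
   and [bounded_set] can be taken from the library. *)
Definition enorm (R : realType) (n : nat) (v : 'rV[R]_n) : R :=
  Num.sqrt (\sum_(i < n) v 0 i ^+ 2).

Definition gradient (R : realType) (n : nat) (f : 'rV[R]_n -> R)
    (y : 'rV[R]_n) : 'rV[R]_n :=
  \row_(i < n) 'D_(delta_mx 0 i) f y.

Definition C1_function (R : realType) (n : nat) (f : 'rV[R]_n -> R) : Prop :=
  (forall y, differentiable f y) /\ continuous (gradient f).

Definition lipschitz_gradient (R : realType) (n : nat) (L : R)
    (f : 'rV[R]_n -> R) : Prop :=
  forall y z, enorm (gradient f y - gradient f z) <= L * enorm (y - z).

Definition level_set (R : realType) (n : nat) (f : 'rV[R]_n -> R) (alpha : R) :
    set 'rV[R]_n :=
  [set y | f y <= alpha].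

Definition optimal_value (R : realType) (n : nat) (f : 'rV[R]_n -> R) : \bar R :=
  ereal_inf [set (f y)%:E | y in [set: 'rV[R]_n]].

Definition global_minimizer (R : realType) (n : nat) (f : 'rV[R]_n -> R)
    (y : 'rV[R]_n) : Prop :=
  forall z, f y <= f z.

(* Sequences start at index 0: [x 0], [t 0], [rho 0] are x^1, t_1, rho_1. *)
Definition perturbed_gradient_sequence (R : realType) (n : nat)
    (f : 'rV[R]_n -> R) (t rho : nat -> R) (x : nat -> 'rV[R]_n) : Prop :=
  forall k, x k.+1 =
    x k - t k *: gradient f
                   (x k + rho k *: ((enorm (gradient f (x k)))^-1 *:
                                    gradient f (x k))).

(* Main.v *)
Require Import Defs.
From HB Require Import structures.
From mathcomp Require Import all_boot all_order all_algebra.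
From mathcomp Require Import all_classical all_reals all_analysis.
From mathcomp Require Import ring lra.
Import Order.TTheory GRing.Theory Num.Theory.
Import numFieldNormedType.Exports.
Local Open Scope classical_set_scope.
Local Open Scope ring_scope.

(** Write [g k] for the gradient at [x k] and [v k] for the gradient at the
    perturbed point. The perturbation goes along [g k], so monotonicity of the
    gradient gives [<g k, v k> >= |g k|^2]: the perturbation never spoils the
    descent direction to first order. Its cost is of second order, since
    [|v k|^2 <= 2 |g k|^2 + 2 (L rho_k)^2] by the Lipschitz condition. With the
    descent inequality this yields, as soon as [4 L t_k <= 1],
    [f (x k.+1) <= f (x k) - t_k |g k|^2 / 2 + C t_k^2]
    where [C] depends on [L] and the bound on the radii ([perturbed_step]).

    The errors [C t_k^2] are summable and the values are bounded below, so the
    values converge and [t_k |g k|^2] is summable ([quasi_descent]). As the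
    [t_k] are not summable, [|g k|] is arbitrarily small infinitely often
    ([frequently_small]); this is assertion (i).

    A convex function with one nonempty bounded level set has only bounded level
    sets ([bounded_level_sets]), hence the iterates, whose values are bounded,
    stay bounded. The tangent plane inequality
    [f (x k) - f z <= <g k, x k - z>] along the indices where [g k] is small
    then shows that the limit of the values is at most [f z] for every [z]
    ([limit_value_le]). So this limit is the infimum, and by continuity it is
    the value of [f] at each accumulation point. If there is only one minimizer,
    the iterates form a bounded sequence with only one accumulation point. *)

(** * Inner product and Euclidean norm *)

Definition dotp {R : realType} {n : nat} (u v : 'rV[R]_n) : R :=
  \sum_(i < n) u 0 i * v 0 i.

Section euclidean.
Context {R : realType} {n : nat}.
Implicit Types u v w : 'rV[R]_n.

Lemma dotpC u v : dotp u v = dotp v u.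
Proof. by apply: eq_bigr => i _; rewrite mulrC. Qed.

Lemma dotpDr u v w : dotp u (v + w) = dotp u v + dotp u w.
Proof. by rewrite -big_split; apply: eq_bigr => i _; rewrite mxE mulrDr. Qed.

Lemma dotpZr a u v : dotp u (a *: v) = a * dotp u v.
Proof. by rewrite big_distrr; apply: eq_bigr => i _; rewrite mxE /=; ring. Qed.

Lemma dotpNr u v : dotp u (- v) = - dotp u v.
Proof. by rewrite -scaleN1r dotpZr mulN1r. Qed.

Lemma dotpBr u v w : dotp u (v - w) = dotp u v - dotp u w.
Proof. by rewrite dotpDr dotpNr. Qed.

Lemma dotpBl u v w : dotp (u - v) w = dotp u w - dotp v w.
Proof. by rewrite dotpC dotpBr !(dotpC w). Qed.

Lemma enorm_sq u : enorm u ^+ 2 = dotp u u.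
Proof.
rewrite /enorm sqr_sqrtr; first by apply: eq_bigr => i _; rewrite expr2.
by apply: sumr_ge0 => i _; exact: sqr_ge0.
Qed.

Lemma enorm_ge0 u : 0 <= enorm u.
Proof. exact: sqrtr_ge0. Qed.

Lemma dotpp_ge0 u : 0 <= dotp u u.
Proof. by rewrite -enorm_sq sqr_ge0. Qed.

Lemma coord_le_enorm u i : `|u 0 i| <= enorm u.
Proof.
rewrite -sqrtr_sqr; apply: ler_wsqrtr.
by rewrite (bigD1 i) //= lerDl; apply: sumr_ge0 => j _; exact: sqr_ge0.
Qed.

Lemma coord_le_norm u i : `|u 0 i| <= `|u|.
Proof.
rewrite [leRHS]/Num.norm /= mx_normrE.
by apply/bigmax_geP; right => /=; exists (0, i).
Qed.

Lemma enorm_gt0 u : u != 0 -> 0 < enorm u.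
Proof.
move=> u0; rewrite lt_neqAle enorm_ge0 andbT eq_sym.
apply: contra u0 => /eqP e0; apply/eqP/rowP => i; apply/eqP; rewrite mxE.
by rewrite -normr_le0 -e0; exact: coord_le_enorm.
Qed.

(** A Cauchy-Schwarz inequality between the Euclidean norm and the sup norm:
    it turns boundedness, which refers to the latter, into bounds on inner
    products. *)
Lemma normr_dotp_le u v : `|dotp u v| <= enorm u * (n%:R * `|v|).
Proof.
apply: (le_trans (ler_norm_sum _ _ _)).
have -> : enorm u * (n%:R * `|v|) = \sum_(i < n) enorm u * `|v|.
  by rewrite sumr_const card_ord -mulr_natl; ring.
apply: ler_sum => i _; rewrite normrM.
by apply: ler_pM => //; [exact: coord_le_enorm | exact: coord_le_norm].
Qed.

End euclidean.

(** * Convex functions with Lipschitz gradient *)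

Section convex_smooth.
Context {R : realType} {n : nat} {f : 'rV[R]_n -> R}.
Implicit Types y z : 'rV[R]_n.

Lemma derive_gradient y v : differentiable f y ->
  'D_v f y = dotp (gradient f y) v.
Proof.
move=> df; rewrite deriveE // [in LHS](row_sum_delta v) linear_sum.
by apply: eq_bigr => i _; rewrite linearZ mxE deriveE //= mulrC.
Qed.

Hypothesis cvxf : convex_function [set: 'rV[R]_n] f.

Lemma convex_segment y z (s : R) : 0 <= s <= 1 ->
  f (y + s *: (z - y)) <= f y + s * (f z - f y).
Proof.
move=> /andP[s0 s1].
have fs : f (s *: z + (1 - s) *: y) <= s * f z + (1 - s) * f y.
  by apply: (cvxf (Itv01 s0 s1)); rewrite inE.
have -> : y + s *: (z - y) = s *: z + (1 - s) *: y.
  by apply/rowP => i; rewrite !mxE; ring.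
lra.
Qed.

(** The graph lies above its tangent planes: the difference quotients of [f]
    from [y] towards [z] are at most [f z - f y] by convexity, and they tend to
    the directional derivative. *)
Lemma convex_gradient_le y z : differentiable f y ->
  dotp (gradient f y) (z - y) <= f z - f y.
Proof.
move=> df; rewrite -derive_gradient //.
have : derivable f y (z - y) by exact: diff_derivable.
move=> /cvg_dnbhs_at_right.
move=> /cvgr_to_le; apply.
near=> h.
have h0 : 0 < h by near: h; exact: nbhs_right_gt.
have h1 : h <= 1 by near: h; apply: nbhs_right_le.
rewrite /= ler_pdivrMl // [_ + y]addrC.
by rewrite lerBlDl; apply: convex_segment; rewrite (ltW h0).
Unshelve. all: by end_near. Qed.

(** The sum of the tangent plane inequalities at [y] and at [z]. *)
Lemma gradient_monotone y z : differentiable f y -> differentiable f z ->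
  0 <= dotp (gradient f z - gradient f y) (z - y).
Proof.
move=> /(convex_gradient_le y z) + /(convex_gradient_le z y).
rewrite -(opprB z y) dotpNr dotpBl => ? ?; lra.
Qed.

(** The tangent plane at the far end point [y] bounds [f y - f z] by
    [<gradient f y, y - z>], which replaces the integral of the gradient along
    the segment at the price of [L] instead of [L / 2] in the quadratic term. *)
Lemma convex_descent (L : R) y z : 0 < L -> lipschitz_gradient L f ->
  differentiable f y ->
  f y <= f z + dotp (gradient f z) (y - z) + L * dotp (y - z) (y - z).
Proof.
move=> L0 lipf /(convex_gradient_le y z); rewrite -(opprB y z) dotpNr => fyz.
have : dotp (gradient f y - gradient f z) (y - z) <= L * dotp (y - z) (y - z).
  have lip2 : dotp (gradient f y - gradient f z) (gradient f y - gradient f z)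
      <= L ^+ 2 * dotp (y - z) (y - z).
    rewrite -!enorm_sq -exprMn lerXn2r ?nnegrE ?enorm_ge0 //.
    by rewrite mulr_ge0 ?enorm_ge0 // ltW.
  move: (gradient f y - gradient f z) (y - z) lip2 => g d lip2.
  (* Young's inequality [2 L <g, d> <= |g|^2 + L^2 |d|^2] *)
  have := dotpp_ge0 (g - L *: d).
  rewrite dotpBr !dotpBl !dotpZr (dotpC (L *: d) g) !(dotpC (L *: d) d).
  rewrite !dotpZr => young; rewrite -(ler_pM2l L0); nra.
by rewrite dotpBl; lra.
Qed.

End convex_smooth.

(** * Level sets of convex functions *)

Section level_sets.
Context {R : realType} {n : nat} {f : 'rV[R]_n -> R}.

(** On a large sphere around a point [x0] of the bounded level set, [f] is
    greater than [alpha], and by compactness its minimum there is greater than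
    [f x0]. Convexity along the rays from [x0] makes [f] grow at least linearly
    outside the sphere, with a positive slope; [D] below is the distance at
    which this growth reaches [beta]. *)
Lemma bounded_level_sets (alpha beta : R) :
  convex_function [set: 'rV[R]_n] f -> continuous f ->
  level_set f alpha !=set0 -> bounded_set (level_set f alpha) ->
  bounded_set (level_set f beta).
Proof.
move=> cvxf contf [x0 fx0] [M [_ lvlM]].
pose r := `|M| + `|x0| + 2.
have r0 : 0 < r by rewrite ltr_wpDl // addr_ge0.
(* if no point is outside the ball, the sphere may be empty ([n = 0]) *)
have [ysub|] := pselect (forall y, `|y - x0| <= r).
  exists (r + `|x0|); split; first exact: num_real.
  move=> C rC y _; apply: le_trans (ltW rC).
  by rewrite -(subrK x0 y) (le_trans (ler_normD _ _)) // lerD2r.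
move=> /existsNP[y0 /negP]; rewrite -ltNge => ry0.
pose S := [set y : 'rV[R]_n | `|y - x0| = r].
have onS y : r < `|y - x0| -> S (x0 + (r / `|y - x0|) *: (y - x0)).
  move=> ry; rewrite /S /= [x0 + _]addrC addrK normrZ normrM normfV normr_id.
  by rewrite (gtr0_norm r0) divfK // gt_eqF // (lt_trans r0).
have outS y : S y -> alpha < f y.
  move=> Sy; rewrite ltNge; apply/negP => fy.
  have : `|y| <= `|M| + 1.
    by apply: lvlM fy; rewrite (le_lt_trans (ler_norm M)) // ltrDl.
  apply/negP; rewrite -ltNge; have := ler_normB y x0; rewrite Sy /r; lra.
have cS : compact S.
  apply: bounded_closed_compact.
    exists (r + `|x0|); split; first exact: num_real.
    move=> C rC y Sy; apply: le_trans (ltW rC).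
    by rewrite -(subrK x0 y) (le_trans (ler_normD _ _)) // lerD2r Sy.
  have -> : S = (fun y => `|y - x0|) @^-1` [set r] by [].
  apply: preimage_closed; last exact: closed_eq.
  move=> y _; apply: (cvg_norm (cvgB cvg_id (cvg_cst x0))).
have [c /set_mem Sc cmin] := EVT_min_rV (ex_intro _ _ (onS _ ry0)) cS
  (continuous_subspaceT contf).
have fc : 0 < f c - f x0 by rewrite subr_gt0 (le_lt_trans fx0) ?outS.
pose D := r * (beta - f x0) / (f c - f x0).
exists (`|x0| + r + `|D|); split; first exact: num_real.
move=> C DC y fy; apply: le_trans (ltW DC).
rewrite -(subrK x0 y) (le_trans (ler_normD _ _)) // [leLHS]addrC -addrA lerD2l.
have [yr|ry] := leP `|y - x0| r; first by rewrite (le_trans yr) // lerDl.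
have y_gt : 0 < `|y - x0| by exact: lt_trans ry.
suff : `|y - x0| <= D.
  by move=> /le_trans; apply; rewrite (le_trans (ler_norm D)) // lerDr ltW.
rewrite ler_pdivlMr // -ler_pdivlMl // mulrA.
have /mem_set /cmin := onS _ ry.
have sle : 0 <= r / `|y - x0| <= 1.
  by rewrite divr_ge0 ?(ltW r0) //= ler_pdivrMr // mul1r ltW.
have := convex_segment cvxf x0 y _ sle; move: sle => /andP[s0 _] fseg fcle.
rewrite [_^-1 * r]mulrC lerBlDl (le_trans fcle) // (le_trans fseg) //.
by rewrite lerD2l ler_wpM2l // lerD2r.
Qed.

End level_sets.

(** * Real sequences and series *)

Section real_sequences.
Context {R : realType}.
Implicit Types a b e t u : nat -> R.

Lemma bounded_series_cvg e (E : R) : (forall k, 0 <= e k) ->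
  (forall k, \sum_(0 <= j < k) e j <= E) -> cvgn (series e).
Proof.
move=> e0 eE; apply: nondecreasing_is_cvgn.
  by apply/nondecreasing_seqP => k; rewrite seriesSr lerDl.
by exists E => _ [k _ <-]; exact: eE.
Qed.

(** Subtracting the partial sums of the errors [e] from [a] gives a sequence
    that is nonincreasing from [N] on and bounded below. It converges, so does
    [a], and its total decrease bounds the sums of [b]. *)
Lemma quasi_descent a b e (m E : R) N :
  (forall k, 0 <= e k) -> (forall k, \sum_(0 <= j < k) e j <= E) ->
  (forall k, 0 <= b k) -> (forall k, m <= a k) ->
  (forall k, (N <= k)%N -> a k.+1 <= a k - b k + e k) ->
  cvgn a /\ exists B, forall k, \sum_(N <= j < k) b j <= B.
Proof.
move=> e0 eE b0 am step.
pose w k := a k - series e k.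
have wstep k : (N <= k)%N -> w k.+1 <= w k - b k.
  by move=> /step; rewrite /w seriesSr; lra.
have wm k : m - E <= w k.
  by have := am k; have := eE k; rewrite /w /series /=; lra.
split.
  have cw : cvgn w.
    suff /cvg_ex[l] : cvgn (fun k => w (k + N)%N).
      by rewrite (cvg_shiftn N w) => /cvgP.
    apply: nonincreasing_is_cvgn.
      apply/nonincreasing_seqP => k; rewrite addSn.
      by apply: le_trans (wstep _ _) _; rewrite ?leq_addl // gerBl.
    by exists (m - E) => _ [k _ <-].
  have -> : a = w \+ series e by apply/funext => k; rewrite /w /= subrK.
  by apply: is_cvgD => //; exact: bounded_series_cvg eE.
exists (w N - (m - E)) => k.
have [Nk|kN] := leqP N k; last first.
  by rewrite big_geq ?subr_ge0 // ltnW.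
apply: le_trans (_ : w N - w k <= _); last by rewrite lerD2l lerN2.
rewrite -(subnKC Nk); elim: (k - N)%N => [|i IH].
  by rewrite addn0 big_geq // subrr.
rewrite addnS big_nat_recr ?leq_addr //=.
have := wstep (N + i)%N (leq_addr _ _); lra.
Qed.

(** If [u] stayed above [eps] from some index on, the sums of [t j] would be at
    most a constant plus [B / eps ^+ 2]. *)
Lemma frequently_small t u (B : R) N :
  (forall k, 0 <= t k) -> (forall k, 0 <= u k) ->
  (forall C, exists k, C < \sum_(0 <= j < k) t j) ->
  (forall k, \sum_(N <= j < k) t j * u j ^+ 2 <= B) ->
  forall eps M, 0 < eps -> exists2 k, (M <= k)%N & u k < eps.
Proof.
move=> t0 u0 tdiv tuB eps M eps0; apply: contrapT => nsmall.
have ularge k : (M <= k)%N -> eps <= u k.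
  by move=> Mk; rewrite leNgt; apply/negP => ukeps; apply: nsmall; exists k.
pose K := maxn N M.
have [k] := tdiv (\sum_(0 <= j < K) t j + B / eps ^+ 2).
apply/negP; rewrite -leNgt.
have eps20 : 0 < eps ^+ 2 by rewrite exprn_gt0.
have B0 : 0 <= B by have := tuB N; rewrite big_geq.
have [Kk|kK] := leqP K k; last first.
  rewrite [X in _ <= X + _](big_cat_nat (n := k)) //= 1?ltnW //.
  by rewrite -addrA lerDl addr_ge0 ?sumr_ge0 // divr_ge0 // ltW.
rewrite (big_cat_nat (n := K)) //= lerD2l ler_pdivlMr //.
apply: le_trans (tuB k).
rewrite [leRHS](big_cat_nat (n := K)) ?leq_maxl //=.
rewrite -[leLHS]add0r lerD //.
  by apply: sumr_ge0 => j _; rewrite mulr_ge0 ?sqr_ge0.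
rewrite big_distrl !big_nat; apply: ler_sum => j /andP[Kj _].
rewrite ler_wpM2l // lerXn2r ?nnegrE ?(ltW eps0) //.
by apply: ularge; rewrite (leq_trans _ Kj) // leq_maxr.
Qed.

Lemma limn_einf_eq0 u : (forall k, 0 <= u k) ->
  (forall eps M, 0 < eps -> exists2 k, (M <= k)%N & u k < eps) ->
  limn_einf (fun k => (u k)%:E) = 0%E.
Proof.
move=> u0 usmall; rewrite limn_einf_lim.
have -> : einfs (fun k => (u k)%:E) = (fun=> 0%E).
  apply/funext => M; apply/eqP; rewrite eq_le; apply/andP; split; last first.
    by apply: le_ereal_inf_tmp => _ [k _ <-]; rewrite lee_fin.
  apply/lee_addgt0Pr => eps eps0; rewrite add0e.
  have [k Mk uk] := usmall eps M eps0.
  apply: le_trans (_ : (u k)%:E <= _)%E; last by rewrite lee_fin ltW.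
  by apply: ereal_inf_lbound; exists k.
exact: lim_cst.
Qed.

Lemma nneseries_finite e : (forall k, 0 <= e k) ->
  (\sum_(0 <= k <oo) (e k)%:E < +oo)%E ->
  exists E, forall k, \sum_(0 <= j < k) e j <= E.
Proof.
move=> e0 efin.
have sfin : (\sum_(0 <= k <oo) (e k)%:E)%E \is a fin_num.
  rewrite ge0_fin_numE //; apply: nneseries_ge0 => k _ _; by rewrite lee_fin.
exists (fine (\sum_(0 <= k <oo) (e k)%:E)%E) => k.
rewrite -lee_fin fineK // -sumEFin.
by apply: nneseries_lim_ge => j _ _; rewrite lee_fin.
Qed.

Lemma nneseries_infinite t : (forall k, 0 <= t k) ->
  (\sum_(0 <= k <oo) (t k)%:E = +oo)%E ->
  forall C, exists k, C < \sum_(0 <= j < k) t j.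
Proof.
move=> t0 tinf C; apply: contrapT => nlarge.
suff : (\sum_(0 <= k <oo) (t k)%:E <= C%:E)%E by rewrite tinf leye_eq.
apply: lime_le; first by apply: is_cvg_nneseries => k _ _; rewrite lee_fin.
apply: nearW => k; rewrite sumEFin lee_fin leNgt; apply/negP => Ck.
by apply: nlarge; exists k.
Qed.

End real_sequences.

(** * Accumulation points *)

Section limit_points.
Context {R : realType} {n : nat}.
Implicit Types (f : 'rV[R]_n -> R) (x : nat -> 'rV[R]_n).

(** The tangent plane at [x k] gives
    [f (x k) - f z <= <gradient f (x k), x k - z>], where the second factor is
    bounded and the first is small for arbitrarily large [k]. Convergence of the
    whole sequence of values is what allows testing only these [k]. *)
Lemma limit_value_le f x (l : R) z :
  convex_function [set: 'rV[R]_n] f -> (forall y, differentiable f y) ->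
  bounded_set (range x) -> f (x k) @[k --> \oo] --> l ->
  (forall eps M, 0 < eps ->
    exists2 k, (M <= k)%N & enorm (gradient f (x k)) < eps) ->
  l <= f z.
Proof.
move=> cvxf df [D [_ xD]] fxl gsmall; rewrite leNgt; apply/negP => fzl.
(* the last [+ 1] keeps [A] positive, so that one can divide by it *)
pose A := n%:R * (`|D| + 1 + `|z|) + 1.
have A1 : n%:R * (`|D| + 1 + `|z|) < A by rewrite ltrDl.
have A0 : 0 < A by rewrite (le_lt_trans _ A1) // mulr_ge0 // !addr_ge0.
have [M _ fxM] := cvgr_gt _ fxl ((f z + l) / 2) ltac:(lra).
have [k Mk gk] := gsmall ((l - f z) / 2 / A) M
  ltac:(by rewrite divr_gt0 // divr_gt0 ?subr_gt0).
have := fxM k Mk; apply/negP; rewrite -leNgt.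
have := convex_gradient_le cvxf (x k) z (df _).
rewrite -(opprB (x k) z) dotpNr => tangent.
have xkD : `|x k| <= `|D| + 1.
  by apply: xD; [rewrite (le_lt_trans (ler_norm D)) // ltrDl | exists k].
have : dotp (gradient f (x k)) (x k - z) <= (l - f z) / 2.
  apply: le_trans (ler_norm _) _; apply: le_trans (normr_dotp_le _ _) _.
  apply: le_trans (_ : enorm (gradient f (x k)) * A <= _).
    rewrite ler_wpM2l ?enorm_ge0 // (le_trans _ (ltW A1)) // ler_wpM2l //.
    by rewrite (le_trans (ler_normB _ _)) // lerD2r.
  by rewrite -ler_pdivlMr // ltW.
lra.
Qed.

Lemma cluster_value f x (l : R) y : continuous f ->
  f (x k) @[k --> \oo] --> l -> cluster (x @ \oo) y -> f y = l.
Proof.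
move=> contf fxl xy; apply/esym/norm_hausdorff => A B lA fyB.
have [z [Az Bz]] := xy (f @^-1` A) (f @^-1` B) (fxl _ lA) (contf y _ fyB).
by exists (f z).
Qed.

(** The sequence lives in a ball, which is compact in finite dimension; the
    ball is chosen large enough to be a neighbourhood of [y] as well. *)
Lemma unique_cluster_cvg x y : bounded_set (range x) ->
  (forall z, cluster (x @ \oo) z -> z = y) -> x @ \oo --> y.
Proof.
move=> [D [_ xD]] xz.
pose B := `|D| + `|y| + 1.
pose V := [set v : 'rV[R]_n | `|v| <= B].
have cptV : compact V.
  apply: bounded_closed_compact.
    exists B; split; first exact: num_real.
    by move=> C BC v Vv; apply: le_trans (ltW BC).
  have -> : V = (fun v => `|v|) @^-1` [set r | r <= B] by [].
  apply: preimage_closed; last exact: closed_le.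
  by move=> v _; exact: norm_continuous.
have xV : \forall k \near \oo, V (x k).
  apply: nearW => k; apply: xD; last by exists k.
  by rewrite /B (le_lt_trans (ler_norm D)) // -addrA ltrDl ltr_wpDl.
apply: (compact_cluster_set1 _ cptV) => //.
- apply: (cvgr_le _ (@norm_continuous _ _ y)).
  by rewrite /B addrAC ltrDr ltr_wpDl.
- apply/seteqP; split=> [z /xz -> //|_ ->].
  by have [z [_ cz]] := cptV (x @ \oo) _ xV; rewrite -(xz z cz).
Qed.

End limit_points.

(** * The perturbed gradient method *)

(** [c] is the perturbation radius divided by [enorm g], so [c * enorm g] is the
    radius itself. Monotonicity of the gradient bounds the first-order term of
    the descent inequality, the Lipschitz condition the second-order one, and
    the restriction on [t] lets half of the decrease absorb the part of the
    second-order term that is proportional to [enorm g ^+ 2]. *)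
Lemma perturbed_step {R : realType} {n : nat} {f : 'rV[R]_n -> R} (L c t : R)
    (x : 'rV[R]_n) :
  convex_function [set: 'rV[R]_n] f -> (forall y, differentiable f y) ->
  0 < L -> lipschitz_gradient L f -> 0 <= c -> 0 <= t -> 4 * L * t <= 1 ->
  let g := gradient f x in
  f (x - t *: gradient f (x + c *: g)) <=
  f x - t * (enorm g ^+ 2 / 2) + 2 * L ^+ 3 * (c * enorm g) ^+ 2 * t ^+ 2.
Proof.
move=> cvxf df L0 lipf c0 t0 tL /=.
set g := gradient f x; set v := gradient f (x + c *: g).
have descent := convex_descent cvxf _ (x - t *: v) x L0 lipf (df _).
(* monotonicity between [x] and [x + c g], divided by [c] *)
have gv : dotp g g <= dotp g v.
  have [c_eq0|c_neq0] := eqVneq c 0; first by rewrite /v c_eq0 scale0r addr0.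
  have := gradient_monotone cvxf x (x + c *: g) (df _) (df _).
  rewrite [x + _]addrC addrK dotpZr pmulr_rge0 ?lt_neqAle 1?eq_sym ?c_neq0 //.
  by rewrite [c *: g + x]addrC dotpBl subr_ge0 (dotpC v).
have vg : dotp v v <= 2 * dotp g g + 2 * L ^+ 2 * (c * enorm g) ^+ 2.
  have : dotp (v - g) (v - g) <= L ^+ 2 * (c * enorm g) ^+ 2.
    have := lipf (x + c *: g) x; rewrite -/v -/g [x + _]addrC addrK => lip.
    have -> : (c * enorm g) ^+ 2 = enorm (c *: g) ^+ 2.
      by rewrite exprMn !enorm_sq dotpZr dotpC dotpZr; ring.
    rewrite -exprMn -enorm_sq lerXn2r ?nnegrE ?enorm_ge0 //.
    by rewrite mulr_ge0 ?enorm_ge0 // ltW.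
  (* [|v|^2 <= 2 |v - g|^2 + 2 |g|^2], the difference being [|v - 2 g|^2] *)
  have := dotpp_ge0 (v - g - g).
  rewrite !(dotpBl, dotpBr) (dotpC v g); lra.
move: descent.
have -> : x - t *: v - x = - t *: v by rewrite addrAC subrr add0r scaleNr.
rewrite !dotpZr (dotpC (- t *: v)) dotpZr -/g enorm_sq.
move: (dotp g g) (dotp g v) (dotp v v) (dotpp_ge0 g) gv vg => a b d a0 ab da.
set e := (c * enorm g) ^+ 2 in da *.
have : 0 <= t * (b - a) by rewrite mulr_ge0 ?subr_ge0.
have : 0 <= L * t ^+ 2 * (2 * a + 2 * L ^+ 2 * e - d).
  by rewrite mulr_ge0 ?subr_ge0 // mulr_ge0 ?sqr_ge0 // ltW.
have : 0 <= t * a * (1 - 4 * L * t).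
  by rewrite mulr_ge0 ?subr_ge0 // mulr_ge0.
lra.
Qed.

Theorem theorem3p2 (R : realType) (n : nat) (f : 'rV[R]_n -> R) (L : R)
    (x1 : 'rV[R]_n) (t rho : nat -> R) (x : nat -> 'rV[R]_n) :
  C1_function f ->
  convex_function [set: 'rV[R]_n] f ->
  0 < L ->
  lipschitz_gradient L f ->
  x 0%N = x1 ->
  perturbed_gradient_sequence f t rho x ->
  (forall k, 0 <= t k) ->
  (forall k, 0 <= rho k) ->
  (\sum_(0 <= k <oo) (t k ^+ 2)%:E < +oo)%E ->
  (\sum_(0 <= k <oo) (t k)%:E = +oo)%E ->
  (ereal_sup (range (fun k => (rho k)%:E)) < +oo)%E ->
  (forall k, gradient f (x k) != 0) ->
  (-oo < ereal_inf (range (fun k => (f (x k))%:E)))%E ->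
  limn_einf (fun k => (enorm (gradient f (x k)))%:E) = 0%E
  /\
  ((exists alpha, level_set f alpha !=set0 /\ bounded_set (level_set f alpha)) ->
   [/\ bounded_set (range x),
       forall y, cluster (x @ \oo) y -> global_minimizer f y,
       (f (x k))%:E @[k --> \oo] --> optimal_value f
     & forall y, unique (global_minimizer f) y -> x @ \oo --> y]).
Proof.
move=> [df _] cvxf L0 lipf _ xstep t0 rho0 t2fin tdiv rhofin gx0 finf.
have [P rhoP] : exists P, forall k, rho k <= P.
  have [y ysup] : exists y : R, (ereal_sup (range (fun k => (rho k)%:E)) <= y%:E)%E.
    case: ereal_sup rhofin => // [r _|_]; first by exists r.
    by exists 0; rewrite leNye.
  exists y => k; rewrite -lee_fin; apply: le_trans ysup.
  by apply: ereal_sup_ubound; exists k.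
have [m mf] : exists m, forall k, m <= f (x k).
  have [y yinf] : exists y : R, (y%:E <= ereal_inf (range (fun k => (f (x k))%:E)))%E.
    case: ereal_inf finf => // [r _|_]; first by exists r.
    by exists 0; rewrite leey.
  exists y => k; rewrite -lee_fin; apply: le_trans yinf _.
  by apply: ereal_inf_lbound; exists k.
have t2_ge0 k : 0 <= t k ^+ 2 by exact: sqr_ge0.
have [E t2E] := nneseries_finite _ t2_ge0 t2fin.
have [N _ tN] : \forall k \near \oo, 4 * L * t k <= 1.
  have /cvg_series_cvg_0 t2_0 := bounded_series_cvg _ _ t2_ge0 t2E.
  have L4 : 0 < 4 * L by rewrite mulr_gt0.
  have : 0 < (4 * L)^-1 ^+ 2 by rewrite exprn_gt0 // invr_gt0.
  move=> /(cvgr_le _ t2_0); apply: filterS => k.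
  rewrite ler_sqr ?nnegrE ?invr_ge0 ?(ltW L4) // => tk.
  by rewrite mulrC -ler_pdivlMr // mul1r.
pose g k := gradient f (x k).
have P0 : 0 <= P by exact: le_trans (rhoP 0%N).
pose C := 2 * L ^+ 3 * P ^+ 2.
have C0 : 0 <= C by rewrite mulr_ge0 ?sqr_ge0 // mulr_ge0 ?exprn_ge0 ?(ltW L0).
have decrease k : (N <= k)%N ->
    f (x k.+1) <= f (x k) - t k * (enorm (g k) ^+ 2 / 2) + C * t k ^+ 2.
  move=> Nk; rewrite xstep scalerA.
  have gk0 : 0 < enorm (g k) by exact: enorm_gt0 (gx0 k).
  have c0 : 0 <= rho k / enorm (g k) by rewrite divr_ge0 // ltW.
  apply: le_trans (perturbed_step _ _ _ _ cvxf df L0 lipf c0 (t0 k) (tN k Nk)) _.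
  rewrite lerD2l ler_wpM2r // divfK ?gt_eqF // ler_wpM2l //.
    by rewrite mulr_ge0 ?exprn_ge0 ?(ltW L0).
  by rewrite lerXn2r ?nnegrE.
have [fcvg [B gB]] : cvgn (f \o x) /\ exists B, forall k,
    \sum_(N <= j < k) t j * (enorm (g j) ^+ 2 / 2) <= B.
  apply: (quasi_descent _ _ (fun k => C * t k ^+ 2) m (C * E)) decrease => // k.
  - by rewrite mulr_ge0.
  - by rewrite -big_distrr ler_wpM2l.
  - by rewrite mulr_ge0 // divr_ge0 ?sqr_ge0.
have gsmall eps M : 0 < eps -> exists2 k, (M <= k)%N & enorm (g k) < eps.
  apply: (frequently_small t (fun k => enorm (g k)) (2 * B) N) => // [k||].
  - exact: enorm_ge0.
  - exact: nneseries_infinite.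
  - move=> k; rewrite mulrC -ler_pdivrMr // big_distrl /=.
    by under eq_bigr do rewrite -mulrA.
split; first by apply: limn_einf_eq0 => // k; exact: enorm_ge0.
move=> [alpha [lvl0 lvlb]].
have contf : continuous f by move=> y; exact: differentiable_continuous.
(* convergent values are bounded, so the iterates lie in one level set *)
have xb : bounded_set (range x).
  have [D [_ fD]] := cvg_seq_bounded fcvg.
  have [M [Mr lvlM]] := bounded_level_sets alpha (`|D| + 1) cvxf contf lvl0 lvlb.
  exists M; split=> // r Mr' _ [k _ <-]; apply: lvlM Mr' _ _.
  apply: le_trans (ler_norm _) _.
  by apply: fD => //; rewrite (le_lt_trans (ler_norm D)) // ltrDl.
have /cvg_ex[l fl] := fcvg.
have lmin z : l <= f z by exact: limit_value_le fl gsmall.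
have cmin y : cluster (x @ \oo) y -> global_minimizer f y.
  by move=> /(cluster_value _ _ _ _ contf fl) fyl z; rewrite fyl.
split=> //.
- have fEl : (f (x k))%:E @[k --> \oo] --> l%:E.
    by apply: cvg_EFin => //; exact: nearW.
  suff -> : optimal_value f = l%:E by [].
  apply/eqP; rewrite eq_le; apply/andP; split; last first.
    by apply: le_ereal_inf_tmp => _ [z _ <-]; rewrite lee_fin.
  apply: (cvge_to_ge fEl); apply: nearW => k.
  by apply: ereal_inf_lbound; exists (x k).
- by move=> y [_ yuniq]; apply: unique_cluster_cvg => // z /cmin /yuniq.
Qed.
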